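(* Let $m>1$ be an integer, let $p_1,\dots,p_m$ be distinct prime numbers, and let $n_1,\dots,n_m,s_1,\dots,s_m$ be positive integers. Put $l_i=p_i^{n_i}-p_i^{n_i-1}$ for $1\le i\le m$, with indices taken in $\mathbb{Z}/(m)$ (so $l_0=l_m$). Then there exists a finite simple left brace $B$ whose multiplicative group $(B,\cdot)$ is metabelian with all Sylow subgroups abelian, and whose additive group satisfies $$(B,+)\cong\prod_{i\in\mathbb{Z}/(m)}\bigl(\mathbb{Z}/(p_i^{n_i})\bigr)^{2s_il_{i-1}+1}.$$
   Context: A left brace is a set $B$ with two binary operations $+$ and $\cdot$ such that $(B,+)$ is an abelian group, $(B,\cdot)$ is a group, and $a\cdot(b+c)+a=a\cdot b+a\cdot c$ for all $a,b,c\in B$. For $a,b\in B$ put $\lambda_a(b)=a\cdot b-a$; then $a\mapsto\lambda_a$ is a homomorphism $(B,\cdot)\to\operatorname{Aut}(B,+)$. An ideal of $B$ is a normal subgroup $I$ of $(B,\cdot)$ such that $\lambda_a(b)\in I$ for all $b\in I$ and $a\in B$. (The identity elements of $(B,+)$ and $(B,\cdot)$ coincide and are denoted $0$.) A left brace $B$ is simple if $B\neq\{0\}$ and $\{0\}$ and $B$ are the only ideals of $B$. A group is metabelian if its commutator subgroup is abelian. *)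

(* Defs.v *)
From HB Require Import structures.
From mathcomp Require Import all_boot all_order all_algebra all_fingroup all_solvable.

Set Implicit Arguments.
Unset Strict Implicit.
Unset Printing Implicit Defensive.

Import GRing.Theory.
Local Open Scope ring_scope.

(* (B, +) is the zmodType structure and (B, .) the groupType structure, both
   on the same carrier. *)
HB.mixin Record Zmodule_Group_isLeftBrace B of GRing.Zmodule B & monoid.Group B := {
  brace_mulDr : forall a b c : B,
    (a * (b + c)%R)%g + a = (a * b)%g + (a * c)%g
}.

#[short(type="leftBraceType")]
HB.structure Definition LeftBrace :=
  {B of GRing.Zmodule B & monoid.Group B & Zmodule_Group_isLeftBrace B}.

(* Viewed as a finGroupType (for [set: B], {group B}, <|, 'Syl_p), a
   finLeftBraceType is its MULTIPLICATIVE group, although a bare finZmodType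
   is canonically the additive one. *)
#[short(type="finLeftBraceType")]
HB.structure Definition FinLeftBrace := {B of LeftBrace B & Finite B}.

Definition brace_lambda (B : leftBraceType) (a b : B) : B := (a * b)%g - a.

Lemma brace_one0 (B : leftBraceType) : (1%g : B) = 0.
Proof.
have := brace_mulDr (1%g : B) 0 0.
by rewrite !mul1g addr0 add0r.
Qed.

Definition brace_ideal (B : finLeftBraceType) (I : {group B}) : Prop :=
  (I <| [set: B])%g /\ (forall a b : B, b \in I -> brace_lambda a b \in I).

Definition simple_brace (B : finLeftBraceType) : Prop :=
  (exists x : B, x != 0) /\
  (forall I : {group B}, brace_ideal I ->
     (I : {set B}) = [set 0] \/ (I : {set B}) = [set: B]).

Definition metabelian (gT : finGroupType) (G : {set gT}) : bool :=
  abelian [~: G, G]%g.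

(* Main.v *)
Require Import Defs.
From HB Require Import structures.
From mathcomp Require Import all_boot all_order all_algebra all_fingroup all_solvable.

(* In the asymmetric product of T by S, with T and S trivial braces, (T x S, +) is
   the extension of T by S given by a symmetric biadditive form b : T x T -> S, and
   (T x S, .) is the semidirect product for an action of S on T by isometries of b.
   Take T = prod_i T_i and S = prod_i Z/q_i, q_i = p_i^(n_i), with T_i a hyperbolic
   module of rank 2 s_i l_(i-1) over Z/q_i, and let 1 in Z/q_(i-1) act on T_i by
   (x, y) |-> (x C, C^-1 y), where C is the companion matrix of the q_(i-1)-th
   cyclotomic polynomial. If C^c <> 1 then 1 - C^c is invertible modulo q_i, since
   it divides p_(i-1). Hence a nonzero ideal, which meets S via b, contains
   T_i as soon as it contains some s in S with s_(i-1) <> 0, then Z/q_i = b(T_i, T_i),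
   then T_(i+1), and so on around the cycle. As b(t, t') = Q(t + t') - Q(t) - Q(t'),
   (t, s) |-> (t, s - Q t) identifies the additive group with T x S.
   The derived subgroup lies in T. Elements (t, s) of an r-subgroup have s_(i-1) = 0
   when p_i = r, so they act trivially on T_i, where their commutators live. *)

Set Implicit Arguments.
Unset Strict Implicit.
Unset Printing Implicit Defensive.

Import GRing.Theory.
Local Open Scope ring_scope.

(** * Abelian groups of dependent families, added pointwise *)

Section DependentFfunZmodule.

Variables (I : finType) (T : I -> zmodType).
Notation dT := {dffun forall i, T i}.

Definition dffun_zero : dT := [ffun i => 0 : T i].
Definition dffun_opp (f : dT) : dT := [ffun i => - f i].
Definition dffun_add (f g : dT) : dT := [ffun i => f i + g i].

Fact dffun_addA : associative dffun_add.
Proof. by move=> f g h; apply/ffunP=> i; rewrite !ffunE addrA. Qed.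
Fact dffun_addC : commutative dffun_add.
Proof. by move=> f g; apply/ffunP=> i; rewrite !ffunE addrC. Qed.
Fact dffun_add0 : left_id dffun_zero dffun_add.
Proof. by move=> f; apply/ffunP=> i; rewrite !ffunE add0r. Qed.
Fact dffun_addN : left_inverse dffun_zero dffun_opp dffun_add.
Proof. by move=> f; apply/ffunP=> i; rewrite !ffunE addNr. Qed.

HB.instance Definition _ :=
  GRing.isZmodule.Build dT dffun_addA dffun_addC dffun_add0 dffun_addN.

Lemma dffunD_E (f g : dT) i : (f + g) i = f i + g i.
Proof. by rewrite ffunE. Qed.

Lemma dffun0_E i : (0 : dT) i = 0.
Proof. by rewrite ffunE. Qed.

Lemma dffunN_E (f : dT) i : (- f) i = - f i.
Proof. by rewrite ffunE. Qed.

Lemma dffunMn_E (f : dT) k i : (f *+ k) i = f i *+ k.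
Proof. by elim: k => [|k IH]; rewrite ?mulr0n ?dffun0_E // !mulrS dffunD_E IH. Qed.

Lemma dffun_sum_E (J : Type) (r : seq J) (P : pred J) (F : J -> dT) i :
  (\sum_(j <- r | P j) F j) i = \sum_(j <- r | P j) F j i.
Proof.
by elim/big_rec2: _ => [|j y x _ <-]; rewrite ?dffun0_E ?dffunD_E.
Qed.

(** The type of a value depends on its index, so [v] is transported along the proof [e] of [i = j];
    uniqueness of such proofs makes the transport trivial at [j = i]. *)
Definition dffun_single i (v : T i) : dT :=
  [ffun j => if i =P j is ReflectT e then ecast k (T k) e v else 0].

Lemma dffun_single_eq i (v : T i) : dffun_single v i = v.
Proof. by rewrite ffunE; case: eqP => // e; rewrite eq_axiomK. Qed.

Lemma dffun_single_neq i j (v : T i) : i != j -> dffun_single v j = 0.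
Proof. by rewrite ffunE; case: eqP. Qed.

Lemma dffun_sum_single (f : dT) : f = \sum_i dffun_single (f i).
Proof.
apply/ffunP=> j; rewrite dffun_sum_E (bigD1 j) //= dffun_single_eq big1 ?addr0 //.
by move=> i /dffun_single_neq->.
Qed.

End DependentFfunZmodule.

HB.instance Definition _ (I : finType) (T : I -> finZmodType) :=
  Finite.on {dffun forall i, T i}.

(** * Cyclic indices and prime-power divisibility *)

Lemma ord_pred_closed_ind m (P : 'I_m -> Prop) :
  (forall i, P (ord_pred i) -> P i) -> forall i j, P i -> P j.
Proof.
move=> step i j Pi.
have valE k : val (iter k (@ordS m) i) = ((i + k) %% m)%N.
  elim: k => [|k IH]; first by rewrite addn0 modn_small.
  by rewrite /= IH addnS -[in LHS]addn1 modnDml addn1.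
have Piter k : P (iter k (@ordS m) i).
  by elim: k => //= k Pk; apply: step; rewrite ordSK.
(* [i + (j + (m - i)) = j + m] is [j] modulo [m]; the plain difference [j - i] would be truncated
   when [j < i]. *)
suff -> : j = iter (j + (m - i)) (@ordS m) i by [].
apply: val_inj; rewrite valE addnCA subnKC; last exact: ltnW.
by rewrite modnDr modn_small.
Qed.

Lemma ord_pred_neq m (j : 'I_m) : (1 < m)%N -> ord_pred j != j.
Proof.
move=> m_gt1; apply: contraTneq m_gt1 => e; rewrite -leqNgt.
have := congr1 val (ord_predK j); rewrite e /=.
have := ltn_ord j; rewrite leq_eqVlt => /predU1P[jm|jm].
  by rewrite jm modnn => j0; rewrite -jm -j0.
by rewrite modn_small // => /esym/eqP; rewrite ltn_eqF.
Qed.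

Lemma Zp_mulrn_card k (z : 'Z_k) : (1 < k)%N -> z *+ k = 0.
Proof. by move=> k1; rewrite -mulr_natr pchar_Zp // mulr0. Qed.

(** A Bezout relation [u a - v c = 1] writes [w] as a combination of [w *+ a] and [w *+ c]. *)
Lemma mulrn_coprime_eq0 (W : zmodType) (w : W) a c :
  (0 < a)%N -> coprime a c -> w *+ a = 0 -> w *+ c = 0 -> w = 0.
Proof.
move=> a0 /(coprimeP _ a0)[[u v] /= e] wa wc.
have le_vu : (v * c <= u * a)%N by rewrite ltnW // -subn_gt0 e.
rewrite -[w]mulr1n -e mulrnBr // [(u * a)%N]mulnC [(v * c)%N]mulnC.
by rewrite !mulrnA wa wc !mul0rn subrr.
Qed.

Lemma Zp_dvdn_eq0 k (a : 'Z_k) : (1 < k)%N -> (k %| a)%N -> a == 0.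
Proof.
move=> k1 dv; apply/eqP/val_inj/eqP; rewrite /= -[_ == _]negbK -lt0n.
apply/negP=> /dvdn_leq/(_ dv); apply/negP; rewrite -ltnNge.
by have := ltn_ord a; rewrite [X in (_ < X)%N]Zp_cast.
Qed.

(** The gcd of [c] and [p^n] is some [p^f] with [f < n]; its Bezout relation is multiplied by
    [p^(n-1-f)]. This will turn a power of [C^c] into the fixed power [C^(p^(n-1))]. *)
Lemma prime_power_multiple p n c : prime p -> (0 < n)%N -> ~~ (p ^ n %| c)%N ->
  exists u v, (c * u = v * p ^ n + p ^ n.-1)%N.
Proof.
move=> pr n0 ndv; have c0 : (0 < c)%N by case: c ndv => //; rewrite dvdn0.
have [u v e _] := egcdnP (p ^ n) c0.
have /dvdn_pfactor : (gcdn c (p ^ n) %| p ^ n)%N := dvdn_gcdr _ _.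
move=> /(_ pr)[f le_fn gE].
have lt_fn : (f <= n.-1)%N.
  rewrite -ltnS prednK // ltn_neqAle le_fn andbT; apply: contraNneq ndv => fn.
  by rewrite -fn -gE dvdn_gcdl.
exists (u * p ^ (n.-1 - f))%N, (v * p ^ (n.-1 - f))%N.
by rewrite mulnA [(c * u)%N]mulnC e gE mulnDl -expnD subnKC // mulnAC.
Qed.

(** * The asymmetric product of two trivial braces *)

Record asym_data := AsymData {
  asym_dom : finZmodType;
  asym_cod : finZmodType;
  asym_form : asym_dom -> asym_dom -> asym_cod;
  asym_act : asym_cod -> asym_dom -> asym_dom;
  asym_formC : forall t u, asym_form t u = asym_form u t;
  asym_formDl : forall t u v,
    asym_form (t + u) v = asym_form t v + asym_form u v;
  asym_act0 : forall t, asym_act 0 t = t;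
  asym_actDl : forall s r t, asym_act (s + r) t = asym_act s (asym_act r t);
  asym_actDr : forall s t u, asym_act s (t + u) = asym_act s t + asym_act s u;
  asym_form_act : forall s t u,
    asym_form (asym_act s t) (asym_act s u) = asym_form t u
}.

(** A new type instead of [T * S], since the product type already carries componentwise addition. *)
Record asym (D : asym_data) := Asym {
  asym_t : asym_dom D;
  asym_s : asym_cod D
}.

Section AsymmetricProduct.

Variable D : asym_data.
Notation T := (asym_dom D).
Notation S := (asym_cod D).
Notation b := (@asym_form D).
Notation act := (@asym_act D).
Notation B := (asym D).

Definition asym_pair (x : B) := (asym_t x, asym_s x).
Definition asym_of_pair (u : T * S) : B := Asym u.1 u.2.

Fact asym_pairK : cancel asym_pair asym_of_pair.
Proof. by case. Qed.

HB.instance Definition _ := Finite.copy B (can_type asym_pairK).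

Lemma asym_formDr t u v : b t (u + v) = b t u + b t v.
Proof. by rewrite asym_formC asym_formDl !(asym_formC t). Qed.

Lemma asym_form0l t : b 0 t = 0.
Proof. by apply: (addrI (b 0 t)); rewrite -asym_formDl !addr0. Qed.

Lemma asym_formNl t u : b (- t) u = - b t u.
Proof. by apply: (addrI (b t u)); rewrite -asym_formDl !subrr asym_form0l. Qed.

Lemma asym_formNr t u : b t (- u) = - b t u.
Proof. by rewrite asym_formC asym_formNl asym_formC. Qed.

Lemma asym_actr0 s : act s 0 = 0.
Proof. by apply: (addrI (act s 0)); rewrite -asym_actDr !addr0. Qed.

Lemma asym_actrN s t : act s (- t) = - act s t.
Proof. by apply: (addrI (act s t)); rewrite -asym_actDr !subrr asym_actr0. Qed.

Definition asym_add (x y : B) : B :=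
  Asym (asym_t x + asym_t y) (asym_s x + asym_s y + b (asym_t x) (asym_t y)).
Definition asym_opp (x : B) : B :=
  Asym (- asym_t x) (- asym_s x + b (asym_t x) (asym_t x)).
Definition asym_mul (x y : B) : B :=
  Asym (asym_t x + act (asym_s x) (asym_t y)) (asym_s x + asym_s y).
Definition asym_inv (x : B) : B :=
  Asym (- act (- asym_s x) (asym_t x)) (- asym_s x).

Fact asym_addA : associative asym_add.
Proof.
move=> [t s] [u r] [v q]; rewrite /asym_add /= asym_formDl asym_formDr !addrA.
by congr Asym; rewrite [RHS](ACl (1*2*4*6*3*5))%AC.
Qed.

Fact asym_addC : commutative asym_add.
Proof.
by move=> x y; rewrite /asym_add asym_formC [_ + asym_t x]addrC [_ + asym_s x]addrC.
Qed.

Fact asym_add0 : left_id (Asym 0 0) asym_add.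
Proof. by move=> [t s]; rewrite /asym_add /= asym_form0l !add0r addr0. Qed.

Fact asym_addN : left_inverse (Asym 0 0) asym_opp asym_add.
Proof.
move=> [t s]; rewrite /asym_add /= asym_formNl addNr; congr Asym.
by rewrite addrAC addrK addNr.
Qed.

HB.instance Definition _ :=
  GRing.isZmodule.Build B asym_addA asym_addC asym_add0 asym_addN.

Fact asym_mulA : associative asym_mul.
Proof.
by move=> x y z; rewrite /asym_mul /= asym_actDr asym_actDl !addrA.
Qed.

Fact asym_mul1 : left_id (Asym 0 0) asym_mul.
Proof. by move=> [t s]; rewrite /asym_mul /= asym_act0 !add0r. Qed.

Fact asym_mulr1 : right_id (Asym 0 0) asym_mul.
Proof. by move=> [t s]; rewrite /asym_mul /= asym_actr0 !addr0. Qed.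

Fact asym_mulV : left_inverse (Asym 0 0) asym_inv asym_mul.
Proof. by move=> [t s]; rewrite /asym_mul /= !addNr. Qed.

Fact asym_mulgV : right_inverse (Asym 0 0) asym_inv asym_mul.
Proof.
by move=> [t s]; rewrite /asym_mul /= asym_actrN -asym_actDl subrr asym_act0 subrr.
Qed.

HB.instance Definition _ :=
  isGroup.Build B asym_mulA asym_mul1 asym_mulr1 asym_mulV asym_mulgV.

Lemma asym_addE (x y : B) : x + y =
  Asym (asym_t x + asym_t y) (asym_s x + asym_s y + b (asym_t x) (asym_t y)).
Proof. by []. Qed.

Lemma asym_mulE (x y : B) : (x * y)%g =
  Asym (asym_t x + act (asym_s x) (asym_t y)) (asym_s x + asym_s y).
Proof. by []. Qed.

Lemma asym_invE (x : B) :
  (x^-1)%g = Asym (- act (- asym_s x) (asym_t x)) (- asym_s x).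
Proof. by []. Qed.

(** Let [u], [v] be the [T]-parts of [y], [z]. After biadditive expansion the [S]-parts differ only
    in [b u v] against [b (act c u) (act c v)], which agree because [act c] is an isometry. *)
Fact asym_mulDr (x y z : B) : (x * (y + z)%R)%g + x = (x * y)%g + (x * z)%g.
Proof.
rewrite !asym_mulE !asym_addE /= asym_actDr; congr Asym.
  by rewrite -!addrA; congr (_ + (_ + _)); rewrite addrC.
set c := asym_s x; rewrite !asym_formDl !asym_formDr asym_form_act.
rewrite ![b (act c _) (asym_t x)]asym_formC.
set A := asym_s y; set E := asym_s z; set F := b (asym_t y) _.
set G := b _ (asym_t x); set H := b _ (act c _); set K := b _ (act c _).
by rewrite !addrA [RHS](ACl (1*2*4*8*3*5*7*6))%AC.
Qed.

End AsymmetricProduct.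

HB.instance Definition _ (D : asym_data) :=
  Zmodule_Group_isLeftBrace.Build (asym D) (@asym_mulDr D).

(** * Lambda maps, commutators and ideals of the asymmetric product *)

Section AsymmetricProductTheory.

Variable D : asym_data.
Notation T := (asym_dom D).
Notation S := (asym_cod D).
Notation b := (@asym_form D).
Notation act := (@asym_act D).
Notation B := (asym D).

Lemma asym_one : (1%g : B) = Asym 0 0.
Proof. by []. Qed.

Lemma asym_lambdaE (x y : B) : brace_lambda x y =
  Asym (act (asym_s x) (asym_t y))
       (asym_s y - b (asym_t x) (act (asym_s x) (asym_t y))).
Proof.
rewrite /brace_lambda asym_mulE -[- x]/(asym_opp x) asym_addE /=.
rewrite asym_formNr asym_formDl; congr Asym; first by rewrite addrC addKr.
by rewrite opprD !addrA [_ + asym_s y]addrC addrK addrK asym_formC.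
Qed.

Lemma asym_mul_t (t u : T) : (Asym t 0 * Asym u 0)%g = Asym (t + u) 0 :> B.
Proof. by rewrite asym_mulE /= asym_act0 addr0. Qed.

Lemma asym_mul_s (t : T) (s r : S) : (Asym t s * Asym 0 r)%g = Asym t (s + r) :> B.
Proof. by rewrite asym_mulE /= asym_actr0 addr0. Qed.

Lemma asym_s_expg (x : B) k : asym_s (x ^+ k)%g = asym_s x *+ k.
Proof. by elim: k => // k IH; rewrite expgS asym_mulE /= IH mulrS. Qed.

Lemma asym_t_expg (t : T) k : (Asym t 0 ^+ k)%g = Asym (t *+ k) 0 :> B.
Proof. by elim: k => // k IH; rewrite expgS IH asym_mul_t mulrS. Qed.

(** The projection to [S] is a homomorphism from the multiplicative group to an abelian group. *)
Lemma asym_s_commg (x y : B) : asym_s [~ x, y]%g = 0.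
Proof.
rewrite commgEl conjgE !asym_mulE !asym_invE /=.
by rewrite [asym_s x + _]addrC addKr addNr.
Qed.

Fact asym_kernel_group_set : group_set [set x : B | asym_s x == 0].
Proof.
apply/group_setP; split=> [|x y]; first by rewrite inE asym_one.
by rewrite !inE asym_mulE /= => /eqP-> /eqP->; rewrite addr0.
Qed.
Definition asym_kernel := group asym_kernel_group_set.

Lemma asym_kernelP (x : B) : reflect (x = Asym (asym_t x) 0) (x \in asym_kernel).
Proof. by rewrite inE; apply: (iffP eqP) => [|->//]; case: x => t s /= ->. Qed.

Lemma asym_kernel_abelian : abelian asym_kernel.
Proof.
apply/centsP=> x /asym_kernelP-> y /asym_kernelP->.
by rewrite /commute !asym_mul_t addrC.
Qed.

Lemma asym_metabelian : metabelian [set: B].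
Proof.
apply: abelianS asym_kernel_abelian; rewrite gen_subG.
by apply/subsetP=> _ /imset2P[x y _ _ ->]; rewrite inE asym_s_commg.
Qed.

Section Ideal.

Variable I : {group B}.
Hypothesis idealI : brace_ideal I.

(** The lambda map of [(-u, 0)] sends [(t, s)] to [(t, s + b t u)], the product of [(t, s)] and
    [(0, b t u)]. *)
Lemma ideal_form_mem (t u : T) (s : S) : Asym t s \in I -> Asym 0 (b t u) \in I.
Proof.
move=> Ix; have [_ /(_ (Asym (- u) 0) _ Ix)] := idealI.
rewrite asym_lambdaE /= asym_act0 asym_formNl opprK asym_formC.
by rewrite -asym_mul_s groupMl.
Qed.

(** Conjugating [(0, s)] by [(-t, 0)] gives [(t - act s t, s)], the product of [(t - act s t, 0)]
    and [(0, s)]. *)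
Lemma ideal_act_mem (s : S) (t : T) : Asym 0 s \in I -> Asym (t - act s t) 0 \in I.
Proof.
move=> Is; have [/andP[_ /normsP/(_ (Asym (- t) 0))nI] _] := idealI.
have eI := nI (in_setT _).
have : (Asym 0 s ^ Asym (- t) 0)%g \in I by rewrite -eI memJ_conjg.
rewrite conjgE !asym_mulE !asym_invE /= !oppr0 !asym_act0 opprK !add0r.
rewrite asym_actrN !addr0.
by rewrite -[s in Asym _ s]add0r -asym_mul_s groupMr.
Qed.

End Ideal.

End AsymmetricProductTheory.

(** * Cyclic families of modules and the simplicity of their brace *)

(** The last four fields feed the group theory: [cyc_exponent] controls the Sylow subgroups, and the
    other three move an ideal from [T] to [S], from [T_i] to [Z/q_i], and from [Z/q_(i-1)] to
    [T_i]. *)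
Record cyclic_family m (q : 'I_m -> nat) := CyclicFamily {
  cyc_dom : 'I_m -> finZmodType;
  cyc_form : forall i, cyc_dom i -> cyc_dom i -> 'Z_(q i);
  cyc_act : forall i, 'Z_(q (ord_pred i)) -> cyc_dom i -> cyc_dom i;
  cyc_formC : forall i (t u : cyc_dom i), cyc_form t u = cyc_form u t;
  cyc_formDl : forall i (t u v : cyc_dom i),
    cyc_form (t + u) v = cyc_form t v + cyc_form u v;
  cyc_act0 : forall i (t : cyc_dom i), cyc_act 0 t = t;
  cyc_actDl : forall i s r (t : cyc_dom i),
    cyc_act (s + r) t = cyc_act s (cyc_act r t);
  cyc_actDr : forall i s (t u : cyc_dom i),
    cyc_act s (t + u) = cyc_act s t + cyc_act s u;
  cyc_form_act : forall i s (t u : cyc_dom i),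
    cyc_form (cyc_act s t) (cyc_act s u) = cyc_form t u;
  cyc_exponent : forall i (t : cyc_dom i), t *+ q i = 0;
  cyc_form_nondegenerate : forall i (t : cyc_dom i),
    t != 0 -> exists u, cyc_form t u != 0;
  cyc_form_onto : forall i z, exists t u : cyc_dom i, cyc_form t u = z;
  cyc_act_onto : forall i s (t : cyc_dom i),
    s != 0 -> exists u, u - cyc_act s u = t
}.

Section CyclicFamilyTheory.

Variables (m : nat) (q : 'I_m -> nat) (F : cyclic_family q).

Notation V := (cyc_dom F).
Notation T := {dffun forall i, V i}.
Notation Z := (fun i => 'Z_(q i) : finZmodType).
Notation S := {dffun forall i, Z i}.

Definition cyclic_form (t u : T) : S := [ffun i => cyc_form (t i) (u i) : Z i].
Definition cyclic_act (s : S) (t : T) : T :=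
  [ffun i => cyc_act (s (ord_pred i)) (t i)].

Fact cyclic_formC t u : cyclic_form t u = cyclic_form u t.
Proof. by apply/ffunP=> i; rewrite !ffunE cyc_formC. Qed.
Fact cyclic_formDl t u v :
  cyclic_form (t + u) v = cyclic_form t v + cyclic_form u v.
Proof. by apply/ffunP=> i; rewrite !ffunE cyc_formDl. Qed.
Fact cyclic_act0 t : cyclic_act 0 t = t.
Proof. by apply/ffunP=> i; rewrite !ffunE cyc_act0. Qed.
Fact cyclic_actDl s r t : cyclic_act (s + r) t = cyclic_act s (cyclic_act r t).
Proof. by apply/ffunP=> i; rewrite !ffunE cyc_actDl. Qed.
Fact cyclic_actDr s t u : cyclic_act s (t + u) = cyclic_act s t + cyclic_act s u.
Proof. by apply/ffunP=> i; rewrite !ffunE cyc_actDr. Qed.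
Fact cyclic_form_act s t u :
  cyclic_form (cyclic_act s t) (cyclic_act s u) = cyclic_form t u.
Proof. by apply/ffunP=> i; rewrite !ffunE cyc_form_act. Qed.

Definition cyclic_data := @AsymData T S cyclic_form cyclic_act
  cyclic_formC cyclic_formDl cyclic_act0 cyclic_actDl cyclic_actDr cyclic_form_act.

Notation D := cyclic_data.
Notation B := (asym D).
Notation inT := (fun i (v : V i) => dffun_single v : asym_dom D).
Notation inZ := (fun i (z : 'Z_(q i)) => dffun_single (z : Z i) : asym_cod D).

Lemma cyc_form0 i (t : V i) : cyc_form t 0 = 0.
Proof.
rewrite cyc_formC; apply: (addrI (cyc_form 0 t)).
by rewrite -cyc_formDl !addr0.
Qed.

Lemma cyc_actr0 i (s : 'Z_(q (ord_pred i))) : cyc_act s (0 : V i) = 0.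
Proof. by apply: (addrI (cyc_act s 0)); rewrite -cyc_actDr !addr0. Qed.

Lemma cyclic_form_single i (t : T) (v : V i) :
  asym_form (t : asym_dom D) (inT i v) = inZ i (cyc_form (t i) v).
Proof.
apply/ffunP=> j; rewrite [LHS]ffunE.
have [<-|neq] := eqVneq i j; first by rewrite !dffun_single_eq.
by rewrite !dffun_single_neq // cyc_form0.
Qed.

Lemma cyclic_act_single i (s : S) (v : V i) :
  asym_act (s : asym_cod D) (inT i v) = inT i (cyc_act (s (ord_pred i)) v).
Proof.
apply/ffunP=> j; rewrite [LHS]ffunE.
have [<-|neq] := eqVneq i j; first by rewrite !dffun_single_eq.
by rewrite !dffun_single_neq // cyc_actr0.
Qed.

Lemma single_sub i (v w : V i) : inT i v - inT i w = inT i (v - w).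
Proof.
apply/ffunP=> j; rewrite dffunD_E dffunN_E.
have [<-|neq] := eqVneq i j; first by rewrite !dffun_single_eq.
by rewrite !dffun_single_neq // subr0.
Qed.

Section Simple.

Variable I : {group B}.
Hypothesis idealI : brace_ideal I.

Let dom_in_ideal i := forall v : V i, Asym (inT i v) 0 \in I.

(** Writing [v] as [u - cyc_act (s (i-1)) u] reduces this to [ideal_act_mem] at the vector [u]
    placed at [i], where [s] acts only through its coordinate [i-1]. *)
Lemma ideal_dom_mem i (s : S) :
  Asym (0 : asym_dom D) s \in I -> s (ord_pred i) != 0 -> dom_in_ideal i.
Proof.
move=> Is nz v; have [u <-] := cyc_act_onto v nz.
by rewrite -single_sub -cyclic_act_single; apply: ideal_act_mem.
Qed.

Lemma ideal_cod_mem i : dom_in_ideal i ->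
  forall z : 'Z_(q i), Asym 0 (inZ i z) \in I.
Proof.
move=> Vi z; have [t [u <-]] := cyc_form_onto F z.
have /(ideal_form_mem idealI (inT i u)) := Vi t.
by rewrite cyclic_form_single dffun_single_eq.
Qed.

Lemma ideal_dom_step i : dom_in_ideal (ord_pred i) -> dom_in_ideal i.
Proof.
move=> /ideal_cod_mem/(_ 1)/ideal_dom_mem; apply.
(* ['Z_k] is a nontrivial ring for every [k], so [1] is a nonzero element. *)
by rewrite dffun_single_eq oner_neq0.
Qed.

(** Going round the cycle reaches every coordinate. Inside [T] and inside [S] multiplication is
    addition, so elements supported at one index generate both, and [(t, s)] is the product of
    [(t, 0)] and [(0, s)]. *)
Lemma ideal_full i : dom_in_ideal i -> I = [set: B] :> {set B}.
Proof.
move=> Ii; have IV j : dom_in_ideal j.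
  by apply: ord_pred_closed_ind Ii; exact: ideal_dom_step.
apply/setP=> -[t s]; rewrite inE -[s]add0r -asym_mul_s groupM //.
  rewrite (dffun_sum_single (t : T)).
  elim/big_ind: _ => [|u v Iu Iv|j _]; [exact: group1 | | exact: IV].
  by rewrite -asym_mul_t groupM.
rewrite (dffun_sum_single (s : S)).
elim/big_ind: _ => [|u v Iu Iv|j _]; [exact: group1 | | exact: ideal_cod_mem].
by rewrite -asym_mul_s groupM.
Qed.

Lemma ideal_cod_full (s : S) :
  Asym (0 : asym_dom D) s \in I -> s != 0 -> I = [set: B] :> {set B}.
Proof.
move=> Is nz; have [i nzi] : exists i, s i != 0.
  apply/existsP; apply: contraR nz; rewrite negb_exists => /forallP s0.
  by apply/eqP/ffunP=> i; apply/eqP; rewrite dffun0_E -[_ == _]negbK s0.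
by apply: (@ideal_full (ordS i)); apply: ideal_dom_mem Is _; rewrite ordSK.
Qed.

Lemma ideal_trivial_or_full :
  I = [set 0] :> {set B} \/ I = [set: B] :> {set B}.
Proof.
have [I1|I1] := eqVneq (I : {set B}) [set 0]; first by left.
right.
have /subsetPn[[t s] Ix]: ~~ (I \subset [set (0 : B)]).
  apply: contra I1 => sI; rewrite eqEsubset sI sub1set.
  by rewrite -brace_one0 group1.
(* If [t = 0] then [s] is nonzero and the element already lies in [S]; otherwise nondegeneracy at a
   nonzero coordinate of [t] puts a nonzero element of [S] in the ideal. *)
rewrite inE => nz; have [t0|nzt] := eqVneq t 0.
  by rewrite t0 in Ix nz; apply: (ideal_cod_full Ix); apply: contraNneq nz => ->.
have [i nzi] : exists i, (t : T) i != 0.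
  apply/existsP; apply: contraR nzt; rewrite negb_exists => /forallP t0.
  by apply/eqP/ffunP=> i; apply/eqP; rewrite dffun0_E -[_ == _]negbK t0.
have [u nzu] := cyc_form_nondegenerate nzi.
apply: (@ideal_cod_full (inZ i (cyc_form ((t : T) i) u))).
  by rewrite -cyclic_form_single; apply: ideal_form_mem Ix.
by apply: contraNneq nzu => /ffunP/(_ i); rewrite dffun_single_eq dffun0_E => ->.
Qed.

End Simple.

(** The index argument supplies a coordinate, hence a nonzero element of the brace. *)
Lemma cyclic_brace_simple : 'I_m -> simple_brace B.
Proof.
move=> i; split; last exact: ideal_trivial_or_full.
exists (Asym 0 (inZ i 1)); apply: contraNneq (oner_neq0 'Z_(q i)).
by case=> /ffunP/(_ i); rewrite dffun_single_eq dffun0_E => ->.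
Qed.

(** * Commutativity of the subgroups of prime-power order *)

Section Sylow.

Variables (p n : 'I_m -> nat).
Hypotheses (m_gt1 : (1 < m)%N) (p_prime : forall i, prime (p i)).
Hypotheses (p_inj : injective p) (n_gt0 : forall i, (0 < n i)%N).
Hypothesis qE : forall i, q i = (p i ^ n i)%N.

Lemma cyclic_brace_pgroup_abelian r (P : {group B}) :
  prime r -> (r.-group P)%g -> abelian P.
Proof.
move=> r_prime rP; have [e cardP] := p_natP rP.
(* The coordinate is killed by [q j] and by [r ^ e], the order of [P], and these are coprime. *)
have exp_cod j (x : B) : x \in P -> p j != r -> (asym_s x : S) j = 0.
  move=> Px neq; apply: (@mulrn_coprime_eq0 _ _ (q j) (r ^ e)).
  - by rewrite qE expn_gt0 prime_gt0.
  - by rewrite qE coprimeXl // coprimeXr // prime_coprime // dvdn_prime2.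
  - by apply: Zp_mulrn_card; rewrite qE -(exp1n (n j)) ltn_exp2r // prime_gt1.
  have : asym_s (x ^+ (r ^ e))%g = 0 by rewrite -cardP expg_cardG.
  by rewrite asym_s_expg => /ffunP/(_ j); rewrite dffunMn_E dffun0_E.
have exp_dom j (t : T) : Asym (t : asym_dom D) 0 \in P -> p j != r -> t j = 0.
  move=> Pt neq; apply: (@mulrn_coprime_eq0 _ _ (q j) (r ^ e)).
  - by rewrite qE expn_gt0 prime_gt0.
  - by rewrite qE coprimeXl // coprimeXr // prime_coprime // dvdn_prime2.
  - exact: cyc_exponent.
  have : (Asym (t : asym_dom D) 0 ^+ (r ^ e))%g = 1%g by rewrite -cardP expg_cardG.
  by rewrite asym_t_expg => -[/ffunP/(_ j)]; rewrite dffunMn_E dffun0_E.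
(* Here [m > 1] enters: the preceding index carries a prime other than [r]. *)
have act_trivial j (x : B) : x \in P -> p j = r -> (asym_s x : S) (ord_pred j) = 0.
  move=> Px pj; by apply: exp_cod; rewrite // -pj (inj_eq p_inj) ord_pred_neq.
apply/centsP=> x Px y Py; apply/commgP/eqP.
set c := [~ x, y]%g; have Pc : c \in P by rewrite groupR.
have cE : c = Asym (asym_t c) 0 by apply/asym_kernelP; rewrite inE asym_s_commg.
have xyE : (y * x * c = x * y)%g by rewrite -commgC. clearbody c.
rewrite cE asym_one; congr Asym; apply/ffunP=> j; rewrite dffun0_E.
have [pj|] := eqVneq (p j) r; last by apply: exp_dom; rewrite -cE.
(* Where [p j = r], both elements act trivially, so coordinate [j] of [xyE] reads
   [y_j + x_j + c_j = x_j + y_j]. *)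
have /(congr1 (fun z : B => (asym_t z : T) j)) := xyE.
rewrite !asym_mulE /= !ffunE !act_trivial // !add0r !cyc_act0.
rewrite [in RHS]addrC -[RHS]addr0; exact: addrI.
Qed.
End Sylow.
End CyclicFamilyTheory.

(** * Matrix roots of cyclotomic polynomials *)

Section CyclotomicMatrix.

Variable R : comUnitRingType.

Lemma monic_horner_mx_root (P : {poly R}) d :
  P \is monic -> size P = d.+2 -> exists A : 'M[R]_d.+1, horner_mx A P = 0.
Proof.
(* The companion matrix is generalized so that its dimension [(size P).-1] can be rewritten to
   [d.+1]. *)
move=> /companionmxK; move: (companionmx P) => A charA sP.
move: A charA; rewrite sP /= => A charA.
by exists A; rewrite -[P in horner_mx A P]charA Cayley_Hamilton.
Qed.

(** For [k = p^(n-1)] and [r = p - 1] this is the [p^n]-th cyclotomic polynomial. *)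
Lemma sum_polyXn_monic k r : (0 < k)%N ->
  let P : {poly R} := \sum_(j < r.+1) 'X^(k * j) in
  P \is monic /\ size P = (k * r).+1.
Proof.
move=> k0 P; pose Q : {poly R} := \sum_(j < r) 'X^(k * j).
have eP : P = 'X^(k * r) + Q.
  by rewrite /P big_ord_recr /= addrC.
have sQ : (size Q < size ('X^(k * r) : {poly R})%R)%N.
  rewrite size_polyXn ltnS (leq_trans (size_sum _ _ _)) //.
  by apply/bigmax_leqP=> j _; rewrite size_polyXn ltn_pmul2l.
by rewrite eP size_polyDl // size_polyXn monicE lead_coefDl // lead_coefXn.
Qed.

(** Take for [C] a root [A] of the cyclotomic polynomial and for [D] its inverse. With
    [k = p^(n-1)], [1 - A^c] divides [1 - A^k], which divides the unit [p]. *)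
Lemma cyclotomic_matrix p n : prime p -> (0 < n)%N -> p%:R \is a @GRing.unit R ->
  exists C D : 'M[R]_(p ^ n - p ^ n.-1), [/\ C * D = 1, C ^+ (p ^ n) = 1,
    D ^+ (p ^ n) = 1 & forall c, ~~ (p ^ n %| c)%N ->
      1 - C ^+ c \in unitmx /\ 1 - D ^+ c \in unitmx].
Proof.
move=> pr n0 up; set k := (p ^ n.-1)%N.
have k0 : (0 < k)%N by rewrite expn_gt0 prime_gt0.
have pk : (p ^ n = k * p)%N by rewrite -expnSr prednK.
(* This gives the dimension the successor form of [monic_horner_mx_root]. *)
have -> : (p ^ n - k = (k * p.-1).-1.+1)%N.
  rewrite prednK ?muln_gt0 ?k0 -?subn1 ?subn_gt0 ?prime_gt1 //.
  by rewrite pk mulnBr muln1.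
set d := (k * p.-1).-1.
have [A sumA] : exists A : 'M[R]_d.+1, \sum_(j < p) (A ^+ k) ^+ j = 0.
  have [monP sP] := sum_polyXn_monic p.-1 k0.
  case: (@monic_horner_mx_root _ d monP) => [|A].
    by rewrite sP /d prednK // muln_gt0 k0 -subn1 subn_gt0 prime_gt1.
  rewrite prednK ?prime_gt0 // rmorph_sum /= => A0; exists A; rewrite -{}[RHS]A0.
  by apply: eq_bigr => j _; rewrite rmorphXn /= horner_mx_X exprM.
have A1 : A ^+ (p ^ n) = 1.
  by apply/eqP; rewrite -subr_eq0 pk exprM subrX1 sumA mulr0.
have N0 : (0 < p ^ n)%N by rewrite expn_gt0 prime_gt0.
pose D := A ^+ (p ^ n).-1.
have AD : A * D = 1 by rewrite -exprS prednK.
have DA : D * A = 1 by rewrite -exprSr prednK.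
have unitA c : ~~ (p ^ n %| c)%N -> 1 - A ^+ c \in unitmx.
  move=> ndv; have [u [v e]] := prime_power_multiple pr n0 ndv.
  have Ek : (A ^+ c) ^+ u = A ^+ k.
    by rewrite -exprM e exprD mulnC exprM A1 expr1n mul1r.
  (* As the first [p] powers of [A^k] sum to zero, [p] is the sum of the [1 - (A^k)^j], each a
     multiple of [1 - A^k]. *)
  have [W eW] : exists W, p%:R = (1 - A ^+ k) * W.
    exists (\sum_(j < p) \sum_(i < j) (A ^+ k) ^+ i).
    rewrite -[LHS]subr0 -[X in _ - X = _]sumA mulr_sumr.
    rewrite -[p in p%:R]card_ord -sumr_const -sumrB.
    by apply: eq_bigr => j _; rewrite -opprB subrX1 -mulNr opprB.
  pose W' := \sum_(i < u) (A ^+ c) ^+ i.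
  have eW' : 1 - A ^+ k = (1 - A ^+ c) * W'.
    by rewrite -Ek -opprB subrX1 -mulNr opprB.
  suff /mulmx1_unit[] : (1 - A ^+ c) *m ((p%:R)^-1 *: (W' * W)) = 1%:M by [].
  rewrite -scalemxAr -[_ *m _]/(_ * _) mulrA -eW' -eW.
  by rewrite -scaler_nat scalerA mulVr // scale1r.
exists A, D; split => //; first by rewrite -exprM mulnC exprM A1 expr1n.
move=> c ndv; split; first exact: unitA.
have -> : 1 - D ^+ c = - D ^+ c *m (1 - A ^+ c).
  rewrite -[_ *m _]/(_ * _) mulrBr mulr1 mulNr.
  rewrite -exprMn_comm; last by rewrite /GRing.comm DA AD.
  by rewrite DA expr1n opprK addrC.
rewrite unitmx_mul unitA // andbT -scaleN1r unitmxZ ?unitrN1 //.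
have /mulmx1_unit[] // : D ^+ c *m A ^+ c = 1%:M.
by rewrite -[_ *m _]/(_ * _) -exprMn_comm ?DA ?expr1n // /GRing.comm DA AD.
Qed.

End CyclotomicMatrix.

HB.instance Definition _ (U W : finZmodType) := Finite.on (U * W)%type.

(** * Hyperbolic modules of pairs of matrices *)

Section HyperbolicMatrixModule.

Variables (R : finComUnitRingType) (s l N : nat).
Notation W := ('M[R]_(s, l) * 'M[R]_(l, s))%type.

(** The trace makes [l] by [s] matrices the dual of [s] by [l] matrices, so this is the hyperbolic
    form in rank [2 s l]. The [s] rows will carry [s] copies of the action of [C]. *)
Definition hyp_form (t u : W) : R := \tr (t.1 *m u.2) + \tr (u.1 *m t.2).

Lemma hyp_formC t u : hyp_form t u = hyp_form u t.
Proof. by rewrite /hyp_form addrC. Qed.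

Lemma hyp_formDl t u v : hyp_form (t + u) v = hyp_form t v + hyp_form u v.
Proof. by rewrite /hyp_form mulmxDl mulmxDr !mxtraceD addrACA. Qed.

(** Matrix units thus witness both nondegeneracy and surjectivity of the form. *)
Lemma mxtrace_mul_delta m n (A : 'M[R]_(m, n)) i j :
  \tr (A *m delta_mx j i) = A i j.
Proof.
rewrite /mxtrace (bigD1 i) //= big1 ?addr0 => [|i' ne]; rewrite mxE.
  rewrite (bigD1 j) //= big1 ?addr0 => [|j' ne]; rewrite mxE ?eqxx ?mulr1 //.
  by rewrite (negPf ne) mulr0.
by rewrite big1 // => j' _; rewrite mxE (negPf ne) andbF mulr0.
Qed.

Lemma hyp_form_nondegenerate t : t != 0 -> exists u, hyp_form t u != 0.
Proof.
case: t => x y nz; have [x0|/matrix0Pn[i [j nzij]]] := eqVneq x 0.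
  have [y0|/matrix0Pn[i [j nzij]]] := eqVneq y 0; first by rewrite x0 y0 eqxx in nz.
  exists (delta_mx j i, 0); rewrite /hyp_form /= mulmx0 mxtrace0 add0r.
  by rewrite mxtrace_mulC mxtrace_mul_delta.
exists (0, delta_mx j i); rewrite /hyp_form /= mul0mx mxtrace0 addr0.
by rewrite mxtrace_mul_delta.
Qed.

Lemma hyp_form_onto z : (0 < s)%N -> (0 < l)%N -> exists t u, hyp_form t u = z.
Proof.
move=> s0 l0; exists (const_mx z, 0), (0, delta_mx (Ordinal l0) (Ordinal s0)).
by rewrite /hyp_form /= mul0mx mxtrace0 addr0 mxtrace_mul_delta mxE.
Qed.

Lemma hyp_exponent k (t : W) : k%:R = 0 :> R -> t *+ k = 0.
Proof.
move=> k0; case: t => x y.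
suff Mn n : (x, y) *+ n = (x *+ n, y *+ n) :> W.
  by rewrite Mn -[x *+ k]scaler_nat -[y *+ k]scaler_nat k0 !scale0r.
by elim: n => // n IH; rewrite !mulrS IH.
Qed.

(** The form is the polarization of [Q], so subtracting [Q t] from [z] straightens the twisted
    addition. Since [Q t] stands in for half of [hyp_form t t], no division by 2 occurs. *)
Lemma hyp_coordinates : exists2 g : W * R -> 'rV[R]_(2 * s * l + 1), bijective g &
  forall t z u w, g (t + u, z + w + hyp_form t u) = g (t, z) + g (u, w).
Proof.
(* One block for each of the two matrices, and one entry for the scalar. *)
have -> : (2 * s * l + 1 = s * l + l * s + 1)%N.
  by rewrite [(l * s)%N]mulnC addnn -mul2n mulnA.
pose Q (t : W) := \tr (t.1 *m t.2).
pose g (x : W * R) := row_mx (row_mx (mxvec x.1.1) (mxvec x.1.2))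
  (const_mx (x.2 - Q x.1) : 'rV_1).
pose h (v : 'rV[R]_(s * l + l * s + 1)) : W * R :=
  let t := (vec_mx (lsubmx (lsubmx v)), vec_mx (rsubmx (lsubmx v))) in
  (t, (rsubmx v) 0 0 + Q t).
exists g.
  exists h => [[[x y] z]|v].
    by rewrite /h /g /= !row_mxKl !row_mxKr !mxvecK mxE subrK.
  rewrite /h /g /= addrK !vec_mxK hsubmxK.
  rewrite (_ : const_mx _ = rsubmx v) ?hsubmxK //.
  by apply/rowP=> i; rewrite !mxE !ord1.
move=> [x y] z [x' y'] w; rewrite /g /= !add_row_mx -!linearD /=.
congr row_mx; apply/rowP=> i; rewrite !mxE /Q /hyp_form /=.
rewrite mulmxDl !mulmxDr !mxtraceD !opprD !addrA.
by rewrite [LHS](ACl (1*5*2*8*(3*6)*(4*7)))%AC /= !subrr !addr0.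
Qed.

Variables C D : 'M[R]_l.
Hypotheses (CD : C * D = 1) (CN : C ^+ N = 1) (DN : D ^+ N = 1).

Definition hyp_act (a : 'Z_N) (t : W) : W := (t.1 *m C ^+ a, D ^+ a *m t.2).

Lemma hyp_act0 t : hyp_act 0 t = t.
Proof. by case: t => x y; rewrite /hyp_act /= !expr0 mulmx1 mul1mx. Qed.

Lemma hyp_actDl a b t : (1 < N)%N -> hyp_act (a + b) t = hyp_act a (hyp_act b t).
Proof.
move=> N1; case: t => x y.
(* Exponents are representatives, so a sum is reduced modulo [N]; this is harmless as
   [C^N = D^N = 1]. *)
have abE : nat_of_ord (a + b) = ((a + b) %% N)%N by congr modn; exact: Zp_cast.
rewrite /hyp_act abE !expr_mod // [in LHS]addnC exprD addnC exprD /=.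
by rewrite -[_ ^+ b * _]/(_ *m _) -[_ ^+ a * _]/(_ *m _) !mulmxA.
Qed.

Lemma hyp_actDr a t u : hyp_act a (t + u) = hyp_act a t + hyp_act a u.
Proof. by rewrite /hyp_act mulmxDl mulmxDr. Qed.

Lemma hyp_form_act a t u : hyp_form (hyp_act a t) (hyp_act a u) = hyp_form t u.
Proof.
have CDa : C ^+ a *m D ^+ a = 1.
  have DC : D * C = 1 by apply: mulmx1C.
  by rewrite -[_ *m _]/(_ * _) -exprMn_comm ?CD ?expr1n // /GRing.comm CD DC.
by rewrite /hyp_form /= !mulmxA -![_ *m _ *m D ^+ a]mulmxA CDa !mulmx1.
Qed.

Lemma hyp_act_onto (a : 'Z_N) t : 1 - C ^+ a \in unitmx -> 1 - D ^+ a \in unitmx ->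
  exists u, u - hyp_act a u = t.
Proof.
case: t => x y uC uD; exists (x *m invmx (1 - C ^+ a), invmx (1 - D ^+ a) *m y).
rewrite /hyp_act /=; congr pair.
  by rewrite -[X in X - _]mulmx1 -mulmxBr mulmxKV.
by rewrite -[X in X - _]mul1mx -mulmxBl mulKVmx.
Qed.

End HyperbolicMatrixModule.

(** * Assembly of the brace from hyperbolic modules *)

Theorem mainTheorem2 (m : nat) (m_gt1 : (1 < m)%N)
  (p n s : 'I_m -> nat)
  (p_prime : forall i, prime (p i)) (p_inj : injective p)
  (n_gt0 : forall i, (0 < n i)%N) (s_gt0 : forall i, (0 < s i)%N) :
  let l := fun i : 'I_m => (p i ^ n i - p i ^ (n i).-1)%N in
  exists B : finLeftBraceType,
    [/\ simple_brace B,
        metabelian [set: B]%g,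
        (forall (q : nat) (P : {group B}),
           prime q -> P \in ('Syl_q([set: B]))%g -> abelian P)
      & (* ord_pred i is the cyclic predecessor i - 1 modulo m *)
        exists f : B -> {dffun forall i : 'I_m,
                     'rV['Z_(p i ^ n i)]_(2 * s i * l (ord_pred i) + 1)},
          bijective f /\
          (forall (a b : B) (i : 'I_m), f (a + b)%R i = (f a i + f b i)%R)].
Proof.
move=> l; pose q i := (p i ^ n i)%N.
have q_gt1 i : (1 < q i)%N by rewrite -(exp1n (n i)) ltn_exp2r // prime_gt1.
have l_gt0 i : (0 < l i)%N.
  by rewrite subn_gt0 ltn_exp2l ?prime_gt1 // prednK.
have exCD i : exists C D : 'M['Z_(q i)]_(l (ord_pred i)),
    [/\ C * D = 1, C ^+ q (ord_pred i) = 1, D ^+ q (ord_pred i) = 1 &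
    forall c, ~~ (q (ord_pred i) %| c)%N ->
      1 - C ^+ c \in unitmx /\ 1 - D ^+ c \in unitmx].
  (* The cyclotomic polynomial belongs to [p_(i-1)], which differs from [p_i] and is therefore a
     unit modulo [q_i]. *)
  apply: cyclotomic_matrix => //; rewrite unitZpE // coprimeXl //.
  by rewrite prime_coprime // dvdn_prime2 // (inj_eq p_inj) eq_sym ord_pred_neq.
have [C /fin_all_exists[D CD]] := fin_all_exists exCD.
pose V i : finZmodType :=
  ('M['Z_(q i)]_(s i, l (ord_pred i)) * 'M['Z_(q i)]_(l (ord_pred i), s i))%type.
pose form i : V i -> V i -> 'Z_(q i) := @hyp_form _ _ _.
pose act i (a : 'Z_(q (ord_pred i))) : V i -> V i := @hyp_act _ _ _ _ (C i) (D i) a.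
have formC i (t u : V i) : form i t u = form i u t by exact: hyp_formC.
have formDl i (t u v : V i) : form i (t + u) v = form i t v + form i u v.
  exact: hyp_formDl.
have act0 i (t : V i) : act i 0 t = t by exact: hyp_act0.
have actDl i a b (t : V i) : act i (a + b) t = act i a (act i b t).
  by have [_ CN DN _] := CD i; apply: hyp_actDl.
have actDr i a (t u : V i) : act i a (t + u) = act i a t + act i a u.
  exact: hyp_actDr.
have form_act i a (t u : V i) : form i (act i a t) (act i a u) = form i t u.
  by have [CDi _ _ _] := CD i; apply: hyp_form_act.
have exponent i (t : V i) : t *+ q i = 0.
  by apply: hyp_exponent; rewrite pchar_Zp.
have nondeg i (t : V i) : t != 0 -> exists u, form i t u != 0.
  exact: hyp_form_nondegenerate.
have onto i z : exists t u : V i, form i t u = z by exact: hyp_form_onto.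
have act_onto i a (t : V i) : a != 0 -> exists u, u - act i a u = t.
  move=> nz; have [_ _ _ unitCD] := CD i.
  have [uC uD] := unitCD a (contraNN (@Zp_dvdn_eq0 _ a (q_gt1 (ord_pred i))) nz).
  exact: (hyp_act_onto t uC uD).
pose F := CyclicFamily formC formDl act0 actDl actDr form_act
  exponent nondeg onto act_onto.
exists (asym (cyclic_data F)); split.
- by apply: cyclic_brace_simple; exists 0%N; apply: ltnW.
- exact: asym_metabelian.
- move=> r P r_prime; rewrite inE => /pHall_pgroup.
  exact: (cyclic_brace_pgroup_abelian m_gt1 p_prime p_inj n_gt0).
pose X i := 'rV['Z_(q i)]_(2 * s i * l (ord_pred i) + 1).
(* The inverses [h] are chosen along with the [g], so that the inverse of the global map can be
   assembled coordinatewise. *)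
have exg i : exists (g : V i * 'Z_(q i) -> X i) (h : X i -> V i * 'Z_(q i)),
    [/\ cancel g h, cancel h g & forall t z u w,
      g (t + u, z + w + form i t u) = g (t, z) + g (u, w)].
  pose R : finComUnitRingType := 'Z_(q i).
  have [g [h gK hK] gD] := hyp_coordinates R (s i) (l (ord_pred i)).
  by exists g, h.
have [g /fin_all_exists[h gP]] := fin_all_exists exg.
pose B := asym (cyclic_data F).
pose T := {dffun forall i, V i}; pose S := {dffun forall i, 'Z_(q i) : finZmodType}.
exists (fun x : B => [ffun i => g i ((asym_t x : T) i, (asym_s x : S) i)]).
split; last first.
  by move=> a b i; have [_ _ gD] := gP i; rewrite !ffunE gD.
exists (fun y : {dffun forall i, X i} => @Asym (cyclic_data F)
  ([ffun i => (h i (y i)).1] : T) ([ffun i => (h i (y i)).2] : S)).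
  move=> [t z]; congr Asym; apply/ffunP=> i; have [gK _ _] := gP i.
    by rewrite !ffunE gK.
  by rewrite !ffunE gK.
move=> y; apply/ffunP=> i; have [_ hK _] := gP i.
by rewrite !ffunE -surjective_pairing hK.
Qed.
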